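(* For every integer $n\ge 2$, the map $f:\mathrm{CH}_2'(n)\rightarrow \mathrm{MOT}_3(n-2)$ (defined in the context) is a bijection.
   Context: A lattice path of length $n$ is a sequence of points in $\mathbb{N}\times\mathbb{N}$ (with $0\in\mathbb{N}$) starting at $(0,0)$ and ending at $(n,0)$. For a lattice path $((x_0,y_0),\dots,(x_k,y_k))$, each $S_i=(x_i-x_{i-1},y_i-y_{i-1})$ is a step, and the height of $S_i$ is $y_{i-1}$. A lattice path is identified with the word $S_1S_2\cdots S_k$ of its steps. Let $U=(1,1)$, $D=(1,-1)$, $H=(1,0)$. A labeled step is a step together with an integer label; $D_i$ (resp. $H_i$) denotes a down step (resp. a horizontal step) with label $i$. $\mathrm{CH}_2(n)$ is the set of lattice paths $L=S_1S_2\cdots S_n$ of length $n$ consisting of steps $U,D_1,D_2,H_0,H_1,H_2$ such that (i) if $S_i=H_\ell$ or $S_i=D_\ell$, then $S_i$ is of height at least $\ell$; (ii) if $S_i=H_2$ or $S_i=D_2$, then $i\ge2$ and $S_{i-1}\in\{U,H_1,H_2\}$. $\mathrm{CH}_2'(n)$ is the set of $L\in\mathrm{CH}_2(n)$ whose last step is $D_1$. $\mathrm{MOT}_3(n)$ is the set of 3-Motzkin paths of length $n$, i.e. lattice paths of length $n$ consisting of steps $U,D,H_0,H_1,H_2$ (with no further restriction on labels). $A(n)$ is the set of lattice paths of length $n$ which are concatenations of the combined steps $UH_2^k$, $UH_2^kD_2$, $H_1H_2^k$, $H_1H_2^kD_2$, $H_0$, $D_1$ (for any $k\ge0$) and in which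 no $H_2$ touches the $x$-axis (i.e. no $H_2$ has height $0$). $B(n)$ is the set of 3-Motzkin paths of length $n$ in which each $H_2$ touching the $x$-axis (i.e. of height $0$) occurs immediately after $D$, $H_0$ or $H_2$. The map $f_0:A(n)\to B(n)$ sends $L$ to the path obtained from $L$ by changing each combined step $UH_2^kD_2$ to $H_0H_2^{k+1}$, each combined step $H_1H_2^kD_2$ to $DH_2^{k+1}$, and each $D_1$ to $D$ (leaving the other combined steps unchanged). The map $f:\mathrm{CH}_2'(n)\to\mathrm{MOT}_3(n-2)$ is defined as follows. Each $L\in\mathrm{CH}_2'(n)$ decomposes uniquely as $$H_0^{k_1}(U L_1 D_1)H_0^{k_2}(U L_2 D_1)\cdots H_0^{k_r}(U L_r D_1),$$ where $L_i\in A(n_i)$ for some $k_i,n_i\ge0$ and $r\ge1$. Then $$f(L)=H_2^{k_1}f_0(L_1)\,(H_1H_2^{k_2+1}f_0(L_2))\,(H_1H_2^{k_3+1}f_0(L_3))\cdots(H_1H_2^{k_r+1}f_0(L_r)).$$ *)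

(* Defs.v *)
From HB Require Import structures.
From mathcomp Require Import all_boot all_order all_algebra.
From mathcomp Require Import classical_sets functions.

Set Implicit Arguments.
Unset Strict Implicit.
Unset Printing Implicit Defensive.

Import Order.TTheory GRing.Theory Num.Theory.

Local Open Scope ring_scope.
Local Open Scope classical_set_scope.

(* [Dl l] is the labeled down step D_l and [Hl l] the labeled horizontal step
   H_l; [D] is the unlabeled down step, which occurs only in Motzkin paths. *)
Inductive step := U | D | Dl of nat | Hl of nat.

Definition step_code (s : step) : bool + (nat + nat) :=
  match s with
  | U => inl true
  | D => inl false
  | Dl l => inr (inl l)
  | Hl l => inr (inr l)
  end.

Definition step_decode (c : bool + (nat + nat)) : step :=
  match c with
  | inl true => U
  | inl false => D
  | inr (inl l) => Dl l
  | inr (inr l) => Hl l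
  end.

Lemma step_codeK : cancel step_code step_decode.
Proof. by case. Qed.

HB.instance Definition _ := Countable.copy step (can_type step_codeK).

Definition displacement (s : step) : int * int :=
  match s with
  | U => (1, 1)
  | D | Dl _ => (1, -1)
  | Hl _ => (1, 0)
  end.

(* A path is identified with its word of steps; its points are the endpoints of
   the prefixes of the word. *)
Definition word := seq step.

Definition endpoint (L : word) : int * int := \sum_(s <- L) displacement s.

Definition lattice_path (n : nat) (L : word) : Prop :=
  (forall i, (i <= size L)%N ->
     0 <= (endpoint (take i L)).1 /\ 0 <= (endpoint (take i L)).2)
  /\ endpoint L = (n%:Z, 0).

(* Words are indexed from 0: the step S_i of the usual notation is
   [nth U L i.-1], and [height L i] is the height of [nth U L i]. *)
Definition height (L : word) (i : nat) : int := (endpoint (take i L)).2.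

Definition CH2 (n : nat) : set word := [set L |
  [/\ lattice_path n L,
      {subset L <= [:: U; Dl 1; Dl 2; Hl 0; Hl 1; Hl 2]},
      forall i l, (i < size L)%N -> nth U L i = Hl l \/ nth U L i = Dl l ->
        l%:Z <= height L i &
      forall i, (i < size L)%N -> nth U L i = Hl 2 \/ nth U L i = Dl 2 ->
        (0 < i)%N /\ nth U L i.-1 \in [:: U; Hl 1; Hl 2]]].

Definition CH2' (n : nat) : set word :=
  [set L | CH2 n L /\ exists L', L = rcons L' (Dl 1)].

Definition MOT3 (n : nat) : set word :=
  [set M | lattice_path n M /\ {subset M <= [:: U; D; Hl 0; Hl 1; Hl 2]}].

(* The combined steps U H_2^k, U H_2^k D_2, H_1 H_2^k, H_1 H_2^k D_2, H_0 and
   D_1, in this order. *)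
Inductive combined :=
  | CU of nat | CUD of nat | CH of nat | CHD of nat | CH0 | CD1.

Definition combined_code (c : combined) : (nat + nat) + (nat + nat) + bool :=
  match c with
  | CU k => inl (inl (inl k))
  | CUD k => inl (inl (inr k))
  | CH k => inl (inr (inl k))
  | CHD k => inl (inr (inr k))
  | CH0 => inr true
  | CD1 => inr false
  end.

Definition combined_decode (c : (nat + nat) + (nat + nat) + bool) : combined :=
  match c with
  | inl (inl (inl k)) => CU k
  | inl (inl (inr k)) => CUD k
  | inl (inr (inl k)) => CH k
  | inl (inr (inr k)) => CHD k
  | inr true => CH0
  | inr false => CD1
  end.

Lemma combined_codeK : cancel combined_code combined_decode.
Proof. by case. Qed.

HB.instance Definition _ := Countable.copy combined (can_type combined_codeK).

Definition combined_word (c : combined) : word :=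
  match c with
  | CU k => U :: nseq k (Hl 2)
  | CUD k => U :: rcons (nseq k (Hl 2)) (Dl 2)
  | CH k => Hl 1 :: nseq k (Hl 2)
  | CHD k => Hl 1 :: rcons (nseq k (Hl 2)) (Dl 2)
  | CH0 => [:: Hl 0]
  | CD1 => [:: Dl 1]
  end.

Definition combined_factorization (L : word) (s : seq combined) : Prop :=
  L = flatten [seq combined_word c | c <- s].

Definition A (n : nat) : set word := [set L |
  [/\ lattice_path n L,
      exists s, combined_factorization L s &
      forall i, (i < size L)%N -> nth U L i = Hl 2 -> height L i <> 0]].

Definition f0_combined (c : combined) : word :=
  match c with
  | CUD k => Hl 0 :: nseq k.+1 (Hl 2)
  | CHD k => D :: nseq k.+1 (Hl 2)
  | CD1 => [:: D]
  | CU _ | CH _ | CH0 => combined_word c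
  end.

(* A word has at most one factorization into combined steps, so [xget] returns
   it whenever it exists; [[::]] is a default value outside the sets [A n]. *)
Definition f0 (L : word) : word :=
  flatten [seq f0_combined c | c <- xget [::] (combined_factorization L)].

(* The pairs of [d] are (k_1, L_1), ..., (k_r, L_r). *)
Definition CH2'_decomposition (L : word) (d : seq (nat * word)) : Prop :=
  [/\ d <> [::],
      forall p, p \in d -> exists m, A m p.2 &
      L = flatten [seq nseq p.1 (Hl 0) ++ U :: rcons p.2 (Dl 1) | p <- d]].

Definition f_decomposed (d : seq (nat * word)) : word :=
  if d is p :: d' then
    nseq p.1 (Hl 2) ++ f0 p.2 ++
    flatten [seq Hl 1 :: nseq q.1.+1 (Hl 2) ++ f0 q.2 | q <- d']
  else [::].

(* Every word in some [CH2' n] has exactly one decomposition, which is the one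
   returned by [xget]; [[::]] is a default value for the other words. *)
Definition f (L : word) : word :=
  f_decomposed (xget [::] (CH2'_decomposition L)).

(* Main.v *)
Require Import Defs.
From mathcomp Require Import all_boot all_order all_algebra.
From mathcomp Require Import classical_sets functions zify.

Import Order.TTheory GRing.Theory Num.Theory.

(* Prepending D_1 to L in CH_2'(n), and H_1 H_2 to M in MOT_3(n-2), makes the
   first block of the decomposition look like all the others: D_1 L is then the
   word of a sequence of tokens (combined steps and separators D_1 H_0^k U)
   followed by D_1, and H_1 H_2 f(L) is obtained by translating token by token.
   Both tokenizations are bijective because the tokens can be recovered by
   reading the word from left to right: in D_1 L, a D_1 starts a separator
   exactly when it comes down to height 0; in H_1 H_2 M, a token is a letter
   other than H_2 followed by a run of H_2, and H_1 followed by a nonempty run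
   is a separator exactly at height 0. *)

(** * Paths as walks checked one letter at a time *)

Definition descends (s : step) : bool :=
  match s with D | Dl _ => true | _ => false end.

(** Truncation in [h.-1] is harmless: [walk] demands positive height before each descent. *)
Definition height_after (h : nat) (s : step) : nat :=
  match s with U => h.+1 | Hl _ => h | _ => h.-1 end.

(* [ok p h s] allows the step [s] at height [h] just after the step [p]. *)
Fixpoint walk (ok : step -> nat -> step -> bool) p h (L : word) : bool :=
  if L is s :: L' then
    [&& ok p h s, descends s ==> (0 < h) & walk ok s (height_after h s) L']
  else true.

Lemma walk_cat (ok : step -> nat -> step -> bool) p h L1 L2 :
  walk ok p h (L1 ++ L2) =
  walk ok p h L1 && walk ok (last p L1) (foldl height_after h L1) L2.
Proof. by elim: L1 p h => //= s L1 IH p h; rewrite IH !andbA. Qed.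

Lemma endpoint_cons s L : endpoint (s :: L) = (displacement s + endpoint L)%R.
Proof. exact: big_cons. Qed.

Lemma endpoint_nil : endpoint [::] = 0%R.
Proof. exact: big_nil. Qed.

Lemma endpoint_fst L : (endpoint L).1 = (size L)%:Z%R.
Proof.
elim: L => [|s L IH]; first by rewrite endpoint_nil.
by rewrite endpoint_cons /= IH; case: s => [||?|?] /=; lia.
Qed.

Lemma height_after_displacement h s : descends s ==> (0 < h) ->
  ((height_after h s)%:Z = h%:Z + (displacement s).2)%R.
Proof. by case: s => [||?|?] /=; lia. Qed.

Lemma endpoint_snd ok p h L : walk ok p h L ->
  (h%:Z + (endpoint L).2 = (foldl height_after h L)%:Z)%R.
Proof.
elim: L p h => [|s L IH] p h /=; first by rewrite endpoint_nil /= addr0.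
case/and3P=> _ dh /IH <-.
rewrite endpoint_cons (height_after_displacement _ _ dh) /=.
by rewrite addrA.
Qed.

(** The start [h] and the previous step [p] are arbitrary so that induction can drop the first step;
    [nth p (p :: L) i] is the step just before step [i]. *)
Lemma walkP (ok : step -> nat -> step -> bool) p h L :
  (forall i, i <= size L -> (0 <= h%:Z + (endpoint (take i L)).2)%R) /\
  (forall i, i < size L ->
     ok (nth p (p :: L) i) `|(h%:Z + (endpoint (take i L)).2)%R|%N (nth U L i))
  <-> walk ok p h L.
Proof.
elim: L p h => [|s L IH] p h /=.
  split=> // _; split=> // i _; rewrite endpoint_nil /=; lia.
split=> [[pos good]|/and3P[oks dh /IH[pos good]]].
  have := good 0 isT; rewrite /= endpoint_nil addr0 => ->.
  have dh : descends s ==> (0 < h).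
    have := pos 1 isT; rewrite /= take0 endpoint_cons endpoint_nil addr0.
    by case: s {IH good pos} => [||?|?] /=; lia.
  rewrite dh /=; apply/IH; split=> i ilt.
    have := pos i.+1 ilt.
    by rewrite endpoint_cons height_after_displacement //= addrA.
  have := good i.+1 ilt.
  rewrite endpoint_cons height_after_displacement //= addrA.
  by rewrite (set_nth_default s p) //= ltnW.
split=> -[|i] ilt /=; rewrite ?endpoint_nil ?addr0 //.
  by rewrite endpoint_cons /= addrA -height_after_displacement //; apply: pos.
rewrite endpoint_cons /= addrA -height_after_displacement //.
by rewrite (set_nth_default s p) ?good //= ltnW.
Qed.

Lemma lattice_walk (ok : step -> nat -> step -> bool) p n L :
  (lattice_path n L /\ forall i, i < size L ->
     ok (nth p (p :: L) i) `|height L i|%N (nth U L i)) <->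
  [/\ walk ok p 0 L, foldl height_after 0 L = 0 & size L = n].
Proof.
split=> [[[pos end_] good]|[wL end_ sz]].
  have wL : walk ok p 0 L.
    apply/walkP; split=> i ilt; last by rewrite add0r; apply: good.
    by rewrite add0r; case: (pos i ilt).
  have := endpoint_snd _ _ _ _ wL; rewrite end_ /= => hE.
  have := endpoint_fst L; rewrite end_ /= => szE.
  by split=> //; lia.
have := endpoint_snd _ _ _ _ wL; rewrite end_ add0r => hE.
have /walkP[pos good] := wL.
split; last by move=> i ilt; have := good i ilt; rewrite add0r.
split=> [i ilt|].
  split; first by rewrite endpoint_fst.
  by have := pos i ilt; rewrite add0r.
by rewrite [endpoint L]surjective_pairing hE endpoint_fst sz.
Qed.

(** * The sets [A], [MOT3] and [CH2] as walks *)

Definition ok_A (p : step) (h : nat) (s : step) : bool :=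
  (s == Hl 2) ==> (0 < h).

Definition ok_MOT3 (p : step) (h : nat) (s : step) : bool :=
  s \in [:: U; D; Hl 0; Hl 1; Hl 2].

Definition ok_CH2 (p : step) (h : nat) (s : step) : bool :=
  (s \in [:: U; Dl 1; Dl 2; Hl 0; Hl 1; Hl 2]) &&
  match s with
  | Hl l | Dl l => (l <= h) && ((l == 2) ==> (p \in [:: U; Hl 1; Hl 2]))
  | _ => true
  end.

(** The fictitious previous step [Dl 1] is none of U, H_1, H_2, which encodes that H_2 and D_2
    cannot come first. *)
Lemma CH2_walk n L :
  CH2 n L <->
  [/\ walk ok_CH2 (Dl 1) 0 L, foldl height_after 0 L = 0 & size L = n].
Proof.
rewrite -lattice_walk; split=> [[latt sub lab pred]|[latt good]].
  split=> // i ilt; rewrite /ok_CH2 sub ?mem_nth //=.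
  case E: (nth U L i) (lab i ^~ ilt) (pred i ilt) => [||l|l] // lab2 pred2.
    have hl := lab2 l (or_intror erefl); apply/andP; split; first lia.
    apply/implyP=> /eqP l2; subst l; have [i0] := pred2 (or_intror erefl).
    case: i i0 ilt {lab2 pred2 hl E} => // i _ ilt /=.
    by rewrite (set_nth_default U (Dl 1)) // ltnW.
  have hl := lab2 l (or_introl erefl); apply/andP; split; first lia.
  apply/implyP=> /eqP l2; subst l; have [i0] := pred2 (or_introl erefl).
  case: i i0 ilt {lab2 pred2 hl E} => // i _ ilt /=.
  by rewrite (set_nth_default U (Dl 1)) // ltnW.
have pos i : i < size L -> (0 <= height L i)%R.
  by move=> /ltnW ilt; case: latt => /(_ i ilt)[].
split=> //.
- by move=> s /(nthP U)[i ilt <-]; case/andP: (good i ilt).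
- move=> i l ilt Hs; have := pos i ilt; have /andP[_] := good i ilt.
  by case: Hs => ->; lia.
- move=> i ilt Hs; have /andP[_] := good i ilt.
  have {Hs} : forall b c h,
      match nth U L i with
      | Hl l | Dl l => (l <= h) && ((l == 2) ==> b)
      | _ => c
      end -> b.
    by case: Hs => -> b c h /andP[].
  move=> /[apply]; case: i ilt => //= i ilt.
  by rewrite (set_nth_default U (Dl 1)) // ltnW.
Qed.

Lemma MOT3_walk n L :
  MOT3 n L <->
  [/\ walk ok_MOT3 (Dl 1) 0 L, foldl height_after 0 L = 0 & size L = n].
Proof.
rewrite -lattice_walk; split=> -[latt good]; split=> //.
  by move=> i ilt; apply/good/mem_nth.
by move=> s /(nthP U)[i ilt <-]; apply: good.
Qed.

Lemma A_walk n s : let L := flatten [seq combined_word c | c <- s] in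
  A n L <-> [/\ walk ok_A (Dl 1) 0 L, foldl height_after 0 L = 0 & size L = n].
Proof.
move=> L; rewrite -lattice_walk; split=> [[latt _ good]|[latt good]].
  split=> // i ilt; apply/implyP=> /eqP H; have := good i ilt H; lia.
split=> //; first by exists s.
by move=> i ilt H; have := good i ilt; rewrite /ok_A H /=; lia.
Qed.

(** * Token lists and their two words *)

(* The token [inr k] is the separator D_1 H_0^k U between two blocks of a path
   of CH_2', which f turns into H_1 H_2^{k+1}.  Lists of tokens are reversed:
   the last token of the path is the head of the list.  The level of a list is
   the height in the image, one less than the height in the CH_2' path. *)
Definition token := (combined + nat)%type.

Definition word1 (c : token) : word :=
  match c with
  | inl c => combined_word c
  | inr k => Dl 1 :: rcons (nseq k (Hl 0)) U
  end.

Definition word2 (c : token) : word :=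
  match c with
  | inl c => f0_combined c
  | inr k => Hl 1 :: nseq k.+1 (Hl 2)
  end.

Definition unrev_words (w : token -> word) (t : seq token) : word :=
  foldr (fun c L => L ++ w c) [::] t.

Fixpoint level (t : seq token) : nat :=
  match t with
  | [::] => 0
  | inl (CU _) :: t => (level t).+1
  | inl (CHD _) :: t | inl CD1 :: t => (level t).-1
  | _ :: t => level t
  end.

(* Every combined step is preceded by some token, so that the first token is a
   separator. *)
Fixpoint valid (t : seq token) : bool :=
  if t is c :: t' then
    valid t' && match c with
    | inl c => (t' != [::]) &&
      match c with
      | CH k => (k == 0) || (0 < level t')
      | CHD _ | CD1 => 0 < level t'
      | _ => true
      end
    | inr _ => level t' == 0
    end
  else true.

Lemma height_after_nseq h k l : foldl height_after h (nseq k (Hl l)) = h.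
Proof. by elim: k. Qed.

Lemma walk_nseq (ok : step -> nat -> step -> bool) p h k (s : step) :
  (forall p', p' \in [:: p; s] -> ok p' h s) ->
  ~~ descends s -> height_after h s = h ->
  walk ok p h (nseq k s).
Proof.
move=> okp ds ns; elim: k p okp => //= k IH p okp.
rewrite okp ?mem_head // ns (negPf ds) IH // => p'.
by rewrite !inE orbb => /eqP ->; apply: okp; rewrite !inE eqxx orbT.
Qed.

Lemma combined_level t c :
  foldl height_after (level t) (combined_word c) = level (inl c :: t).
Proof.
by case: c => [k|k|k|k||] //=; rewrite ?foldl_rcons height_after_nseq.
Qed.

Lemma walk_nseq_H2 p h k :
  walk ok_A p h (nseq k (Hl 2)) = (k == 0) || (0 < h).
Proof.
by elim: k p => //= k IH p; rewrite IH /ok_A eqxx /=; case: h {IH}; case: k.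
Qed.

(** After a U the height is positive, so only [CH], [CHD] and [CD1] constrain the level; these are
    the side conditions in [valid]. *)
Lemma combined_valid t c : t != [::] ->
  valid (inl c :: t) =
  valid t && walk ok_A (Dl 1) (level t) (combined_word c).
Proof.
move=> /= ->; congr andb.
by case: c => [k|k|k|k||] //=;
  rewrite -?cats1 ?walk_cat ?height_after_nseq ?walk_nseq_H2 //=
    ?andbT ?orbT //;
  case: k; case: level.
Qed.

Definition append_combined (s : seq combined) (t : seq token) : seq token :=
  catrev [seq inl c | c <- s] t.

Lemma walk_ok_A_prev p p' h L : walk ok_A p h L = walk ok_A p' h L.
Proof. by case: L. Qed.

Lemma append_combinedP (s : seq combined) t : t != [::] -> valid t ->
  let L := flatten [seq combined_word c | c <- s] in
  walk ok_A (Dl 1) (level t) L ->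
  [/\ append_combined s t != [::], valid (append_combined s t),
      level (append_combined s t) = foldl height_after (level t) L,
      unrev_words word1 (append_combined s t) = unrev_words word1 t ++ L &
      unrev_words word2 (append_combined s t) =
      unrev_words word2 t ++ flatten [seq f0_combined c | c <- s]].
Proof.
rewrite /append_combined; elim: s t => [|c s IH] t t0 vt /=.
  by rewrite !cats0.
rewrite walk_cat (walk_ok_A_prev _ (Dl 1)) combined_level => /andP[wc ws].
have vc : valid (inl c :: t) by rewrite combined_valid // vt.
have [] := IH (inl c :: t) isT vc ws.
rewrite foldl_cat combined_level => -> -> -> -> ->.
by split=> //=; rewrite catA.
Qed.

(** The list is the very one that [xget] picks in [f0], so a single [s] computes both words. *)
Lemma A_factorization n L : A n L ->
  exists s, [/\ L = flatten [seq combined_word c | c <- s],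
    f0 L = flatten [seq f0_combined c | c <- s],
    walk ok_A (Dl 1) 0 L & foldl height_after 0 L = 0].
Proof.
move=> AL; have [_ [s0 Hs0] _] := AL.
have := xgetPex [::] (ex_intro _ s0 Hs0 : exists s, combined_factorization L s).
rewrite /f0; set s := xget _ _ => Hs; exists s.
move: AL; rewrite {1}Hs => /A_walk[]; rewrite -Hs.
by split.
Qed.

(** * Passing between decompositions and token lists *)

Lemma tokens_of_decomposition (d : seq (nat * word)) t0 :
  (forall p, p \in d -> exists m, A m p.2) -> valid t0 -> level t0 = 0 ->
  exists t, [/\ valid t, level t = 0, (d != [::]) ==> (t != [::]),
    rcons (unrev_words word1 t) (Dl 1) = rcons (unrev_words word1 t0) (Dl 1) ++
      flatten [seq nseq p.1 (Hl 0) ++ U :: rcons p.2 (Dl 1) | p <- d] &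
    unrev_words word2 t = unrev_words word2 t0 ++
      flatten [seq Hl 1 :: nseq p.1.+1 (Hl 2) ++ f0 p.2 | p <- d]].
Proof.
elim: d t0 => [|[k L] d IH] t0 dA v0 l0.
  by exists t0; rewrite !cats0.
have [m /A_factorization[s [LE fE]]] := dA (k, L) (mem_head _ _).
rewrite /= in LE fE *; rewrite LE => wL hL.
have v1 : valid (inr k :: t0) by rewrite /= v0 l0.
have [|n1 v2 l2 w1 w2] := append_combinedP s (inr k :: t0) isT v1.
  by rewrite /= l0.
have [p pd||t [vt lt nt w1' w2']] := IH (append_combined s (inr k :: t0)) _ v2.
- by apply: dA; rewrite inE pd orbT.
- by rewrite l2 /= l0.
exists t; split=> //.
(* An empty [t] would make the left side of [w1'] a single letter. *)
- have := congr1 size w1'; case: (t) => //.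
  rewrite w1 /= size_cat size_rcons !size_cat /= => ?; exfalso; lia.
- by rewrite w1' w1 /= -!cats1 -!catA /= -?catA /= -?catA.
- by rewrite w2' w2 -LE fE -!catA /= -?catA.
Qed.

(** Tokens are peeled off from the end of the path, and [s] collects the combined steps met since
    the last separator. At a separator the level is 0, so the collected word runs from 0 to 0, lies
    in [A] and completes a block. *)
Lemma decomposition_of_tokens t (s : seq combined) : valid t -> t != [::] ->
  let L := flatten [seq combined_word c | c <- s] in
  walk ok_A (Dl 1) (level t) L -> foldl height_after (level t) L = 0 ->
  exists d, [/\ d <> [::], forall p, p \in d -> exists m, A m p.2 &
    rcons (unrev_words word1 t ++ L) (Dl 1) = Dl 1 ::
    flatten [seq nseq p.1 (Hl 0) ++ U :: rcons p.2 (Dl 1) | p <- d]].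
Proof.
elim: t s => // -[c|k] t IH s.
  move=> /= /andP[vt /andP[t0 vc]] _; set L := flatten _ => wL hL.
  have /andP[_ wc] : valid t && walk ok_A (Dl 1) (level t) (combined_word c).
    by rewrite -combined_valid //= vt t0.
  have [||d [d0 dA dE]] := IH (c :: s) vt t0.
  - by rewrite /= walk_cat wc (walk_ok_A_prev _ (Dl 1)) combined_level.
  - by rewrite /= foldl_cat combined_level.
  by exists d; split=> //; rewrite -dE /= -catA.
move=> /= /andP[vt /eqP l0] _; set L := flatten _ => wL hL; rewrite l0 in wL hL.
have AL : A (size L) L by apply/A_walk.
have [->|t0] := eqVneq t [::].
  exists [:: (k, L)]; split=> //= [p|].
    by rewrite inE => /eqP ->; exists (size L).
  by rewrite cats0 -!cats1 -!catA.
have [||d [d0 dA dE]] := IH [::] vt t0; rewrite /= ?l0 //.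
exists (rcons d (k, L)); split.
- by case: (d).
- move=> p; rewrite mem_rcons inE => /orP[/eqP->|/dA//].
  by exists (size L).
- rewrite map_rcons flatten_rcons /= -cat_cons -dE cats0 -!cats1 -!catA /=.
  by rewrite -!catA.
Qed.

(** * Both words of a valid token list are legal paths *)

Lemma size_words t : size (unrev_words word1 t) = size (unrev_words word2 t).
Proof.
elim: t => //= c t IH; rewrite !size_cat IH; congr addn.
by case: c => [[k|k|k|k||]|k] //=; rewrite ?size_rcons !size_nseq.
Qed.

(** Height 1 at the start lets the leading D_1 come down to 0. Inside a block the height is the
    level plus 1, so positive level is the height at least 2 that H_2 and D_2 demand. *)
Lemma walk_words1 p t : valid t -> walk ok_CH2 p 1 (unrev_words word1 t) /\
  foldl height_after 1 (unrev_words word1 t) = (level t).+1.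
Proof.
elim: t => //= c t IH /andP[/IH[wt ht] vc].
rewrite walk_cat foldl_cat ht wt; move: (last _ _) => q.
have wH2 r h k : r \in [:: U; Hl 1; Hl 2] -> 1 < h ->
    walk ok_CH2 r h (nseq k (Hl 2)).
  move=> rP h1; apply: walk_nseq => // p'; rewrite !inE /ok_CH2 /= h1.
  by case/orP=> /eqP->.
have lastH2 r k : r \in [:: U; Hl 1; Hl 2] ->
    last r (nseq k (Hl 2)) \in [:: U; Hl 1; Hl 2].
  by elim: k r => //= k IHk r _; apply: IHk.
case: c vc => [c /andP[_]|k /eqP->].
  case: c => [k|k|[|k]|k||] //= vc;
    by rewrite -?cats1 ?walk_cat ?foldl_cat ?height_after_nseq ?wH2 //=
         /ok_CH2 ?lastH2 //=; move: vc; case: (level t).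
rewrite /= -cats1 walk_cat foldl_cat height_after_nseq andbT /=; split=> //.
by apply: walk_nseq => // p' _.
Qed.

Lemma walk_words2 p t : valid t -> walk ok_MOT3 p 0 (unrev_words word2 t) /\
  foldl height_after 0 (unrev_words word2 t) = level t.
Proof.
elim: t => //= c t IH /andP[/IH[wt ht] vc].
rewrite walk_cat foldl_cat ht wt; move: (last _ _) => q.
have wH2 r h k : walk ok_MOT3 r h (nseq k (Hl 2)).
  by apply: walk_nseq.
case: c vc => [c /andP[_]|k /eqP->].
  by case: c => [k|k|k|k||] //= vc; rewrite ?height_after_nseq ?wH2 //= vc.
by rewrite /= wH2 height_after_nseq.
Qed.

(** * Recovering the tokens from either word *)

Lemma foldl_nseq_count (S T : Type) (push : S -> T -> S) (C : nat -> S) x :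
  (forall j, push (C j) x = C j.+1) ->
  forall k j, foldl push (C j) (nseq k x) = C (j + k).
Proof.
by move=> H; elim=> [|k IH] j /=; rewrite ?addn0 // H IH addnS.
Qed.

(** The head of the list is the token being read. A first H_2 turns H_0 or D into [CUD 0] or
    [CHD 0], whose images carry exactly one H_2. *)
Definition push2 (t : seq token) (s : step) : seq token :=
  match s, t with
  | U, _ => inl (CU 0) :: t
  | D, _ | Dl _, _ => inl CD1 :: t
  | Hl 0, _ => inl CH0 :: t
  | Hl 1, _ => inl (CH 0) :: t
  | _, inl (CU k) :: t' => inl (CU k.+1) :: t'
  | _, inl (CH k) :: t' =>
      if level t' == 0 then inr k :: t' else inl (CH k.+1) :: t'
  | _, inl (CUD k) :: t' => inl (CUD k.+1) :: t'
  | _, inl (CHD k) :: t' => inl (CHD k.+1) :: t'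
  | _, inl CH0 :: t' => inl (CUD 0) :: t'
  | _, inl CD1 :: t' => inl (CHD 0) :: t'
  | _, inr k :: t' => inr k.+1 :: t'
  | _, [::] => [::]
  end.

Lemma push2K t : valid t -> foldl push2 [::] (unrev_words word2 t) = t.
Proof.
elim: t => //= c t IH /andP[/IH tE vc]; rewrite foldl_cat tE.
have run := @foldl_nseq_count _ _ push2 _ (Hl 2).
case: c vc => [[k|k|k|k||]|k] /= vc //.
- exact: (run (fun j => inl (CU j) :: t)).
- exact: (run (fun j => inl (CUD j) :: t)).
- case/andP: vc => _ /orP[/eqP->//|l0].
  by apply: (run (fun j => inl (CH j) :: t)) => j /=; case: level l0.
- exact: (run (fun j => inl (CHD j) :: t)).
- rewrite vc; exact: (run (fun j => inr j :: t)).
Qed.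

(** [[:: inr 0]] is the state after the prepended H_1 H_2; from there each letter keeps the list
    valid and spelling what was read. *)
Lemma push2P M : walk ok_MOT3 (Dl 1) 0 M ->
  let t := foldl push2 [:: inr 0] M in
  [/\ valid t, t != [::], level t = foldl height_after 0 M &
      unrev_words word2 t = Hl 1 :: Hl 2 :: M].
Proof.
elim/last_ind: M => // M s IH /=.
rewrite -cats1 walk_cat !foldl_cat /= => /andP[/IH/=[]].
move: (foldl push2 _ _) (last _ _) => t q vt t0 <- wE /and3P[okq ds _].
have -> : [:: Hl 1, Hl 2 & M ++ [:: s]] = [:: Hl 1, Hl 2 & M] ++ [:: s] by [].
rewrite -wE {wE}.
have nseqS (x : step) k : rcons (nseq k x) x = x :: nseq k x.
  by elim: k => //= k ->.
case: s okq ds => [|||[|[|[|l]]]] //= _ ds; try by rewrite vt ?t0 ?ds /=.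
case: t t0 vt ds => // -[[k|k|k|k||]|k] t _ //= /andP[vt vc] _;
  rewrite ?vt -?catA ?cats1 /= ?nseqS //.
(* At level 0 validity forces k = 0 in [CH k], so H_2 turns it into [inr 0]. *)
case/andP: vc => t0; case: (posnP (level t)) => [l0|lt].
  by rewrite orbF => /eqP-> /=; rewrite vt l0.
by rewrite /= vt t0 lt orbT.
Qed.

Definition state := (seq token * option nat)%type.

(* The state [(t, Some j)] stands for the word of [t] followed by
   D_1 H_0^j at height 0, i.e. by an unfinished separator. *)
Definition push1 (st : state) (s : step) : state :=
  let (t, o) := st in
  match o, s with
  | Some j, U => (inr j :: t, None)
  | Some j, _ => (t, Some j.+1)
  | None, U => (inl (CU 0) :: t, None)
  | None, Hl 0 => (inl CH0 :: t, None)
  | None, Hl 1 => (inl (CH 0) :: t, None)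
  | None, Dl 1 => if level t == 0 then (t, Some 0) else (inl CD1 :: t, None)
  | None, Hl _ =>
      (match t with
       | inl (CU k) :: t' => inl (CU k.+1) :: t'
       | inl (CH k) :: t' => inl (CH k.+1) :: t'
       | _ => t
       end, None)
  | None, _ =>
      (match t with
       | inl (CU k) :: t' => inl (CUD k) :: t'
       | inl (CH k) :: t' => inl (CHD k) :: t'
       | _ => t
       end, None)
  end.

Lemma push1K t : valid t ->
  foldl push1 ([::], None) (unrev_words word1 t) = (t, None).
Proof.
elim: t => //= c t IH /andP[/IH tE vc]; rewrite foldl_cat tE.
have runU k : foldl push1 (inl (CU 0) :: t, None) (nseq k (Hl 2)) =
    (inl (CU k) :: t, None).
  exact: (@foldl_nseq_count _ _ push1 (fun j => (inl (CU j) :: t, None))).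
have runH k : foldl push1 (inl (CH 0) :: t, None) (nseq k (Hl 2)) =
    (inl (CH k) :: t, None).
  exact: (@foldl_nseq_count _ _ push1 (fun j => (inl (CH j) :: t, None))).
case: c vc => [[k|k|k|k||]|k] /= vc; rewrite ?foldl_rcons ?runU ?runH //=.
  (* A valid [CD1] sits at positive level, so its D_1 does not open a separator. *)
  by case/andP: vc => _; case: (level t).
by rewrite vc (@foldl_nseq_count _ _ push1 (fun j => (t, Some j))).
Qed.

(** [Some 0] is the state after the prepended D_1. The invariant: the state spells the prefix read,
    at height 0 in an unfinished separator and at level plus 1 otherwise. *)
Lemma push1P L : walk ok_CH2 (Dl 1) 0 L ->
  let (t, o) := foldl push1 ([::], Some 0) L in
  valid t /\ if o is Some j then
    [/\ level t = 0, foldl height_after 0 L = 0 &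
        Dl 1 :: L = unrev_words word1 t ++ Dl 1 :: nseq j (Hl 0)]
  else
    [/\ t != [::], foldl height_after 0 L = (level t).+1 &
        Dl 1 :: L = unrev_words word1 t].
Proof.
elim/last_ind: L => // L s IH.
rewrite -cats1 walk_cat !foldl_cat /= => /andP[/IH{IH}/=].
have -> : last (Dl 1) L = last U (Dl 1 :: L) by [].
have -> : Dl 1 :: L ++ [:: s] = (Dl 1 :: L) ++ [:: s] by [].
case: (foldl push1 _ _) => t o.
move: (Dl 1 :: L) (foldl height_after _ _) => {}L h.
case: o => [j|] [vt [H1 H2 H3]].
  rewrite H2; case/and3P=> okq ds _.
  have jS : nseq j (Hl 0) ++ [:: Hl 0] = Hl 0 :: nseq j (Hl 0).
    by rewrite cats1; elim: j {H3} => //= j ->.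
  rewrite {}H3 -catA /= ?jS.
  case: s okq ds => [||[|[|[|l]]]|[|[|[|l]]]] //= _ _.
    by rewrite vt H1 cats1.
  by rewrite jS.
have nseqS k : nseq k (Hl 2) ++ [:: Hl 2] = Hl 2 :: nseq k (Hl 2).
  by rewrite cats1; elim: k => //= k ->.
(* H_2 and D_2 need height at least 2, hence positive level. A separator also ends in U but leaves
   level 0, so the last token is [CU] or [CH]. *)
have run : 0 < level t ->
    last U (unrev_words word1 t) \in [:: U; Hl 1; Hl 2] ->
    exists k t', t = inl (CU k) :: t' \/ t = inl (CH k) :: t'.
  case: t vt {H1 H2 H3} => // -[[k|k|k|k||]|k] t /= vt lt;
    rewrite last_cat /= ?last_rcons // => _.
  - by exists k, t; left.
  - by exists k, t; right.
  - by case/andP: vt lt => _ /eqP->.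
rewrite {}H3 {}H2; case/and3P=> okq ds _.
case: s okq ds => [||[|[|[|l]]]|[|[|[|l]]]] //= okq _; try by rewrite vt H1.
- case: eqP => [->|/eqP l0] //=.
  by rewrite vt H1 lt0n l0 /=; case: (level t) l0.
- case/andP: okq => _ /= /andP[lt /(run lt)[k [t' [E|E]]]];
    rewrite {}E /= in vt lt *; rewrite -catA /= cats1.
  + by case/and3P: vt => -> ->.
  + by case/and3P: vt => -> -> _; rewrite (lt : 0 < level t') prednK.
- case/andP: okq => _ /= /andP[lt /(run lt)[k [t' [E|E]]]];
    rewrite {}E /= in vt lt *; rewrite -catA /= nseqS //.
  by case/and3P: vt => -> -> _; rewrite (lt : 0 < level t').
Qed.

(** * The token list behind [f], and bijectivity *)

Lemma CH2'_tokens n L : CH2' n L -> exists t,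
  [/\ valid t, level t = 0, t != [::],
      rcons (unrev_words word1 t) (Dl 1) = Dl 1 :: L &
      unrev_words word2 t = [:: Hl 1, Hl 2 & f L]].
Proof.
case=> /CH2_walk[wL hL _] [L' LE]; subst L.
have [t [vt l0 t0 wE]] : exists t, [/\ valid t, level t = 0, t != [::] &
    Dl 1 :: L' = unrev_words word1 t].
  move: wL hL; rewrite -cats1 walk_cat foldl_cat /= => /andP[/push1P wL].
  case/and3P=> _ hL _ h0; move: wL; case: (foldl push1 _ _) => t o [vt].
  (* The final D_1 goes from height 1 to 0, so the reader is not inside a separator and the level is
     0. *)
  case: o => [j [_ hL0 _]|[t0 hE wE]]; first by rewrite hL0 in hL.
  by exists t; split=> //; move: h0; rewrite hE.
have [d dP] : exists d, CH2'_decomposition (rcons L' (Dl 1)) d.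
  have [||d [d0 dA dE]] := decomposition_of_tokens t [::] vt t0; rewrite ?l0 //.
  by exists d; split=> //; move: dE; rewrite /= cats0 -wE => -[].
(* [t] served to show that a decomposition exists; [t'] is built from the one [xget] returns, on
   which [f] is computed. *)
have {d dP} := xgetPex [::] (ex_intro _ d dP).
rewrite /f; case: (xget _ _) => [[]//|p d] [_ dA LE].
have [t' [vt' lt' nt' w1 w2]] :=
  tokens_of_decomposition (p :: d) [::] dA isT erefl.
exists t'; split=> //; first by rewrite w1 LE.
by rewrite w2 /= -catA.
Qed.

Theorem theorem2p1 (n : nat) (hn : (2 <= n)%N) :
  set_bij (CH2' n) (MOT3 (n - 2)%N) f.
Proof.
split.
- move=> L CL; have [t [vt l0 t0 E1 E2]] := CH2'_tokens n L CL.
  apply/MOT3_walk; case: CL => /CH2_walk[_ _ szL] _.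
  have [] := walk_words2 (Dl 1) t vt; rewrite E2 l0 /= => wf hf.
  split=> //; first by case: (f L) wf.
  have := size_words t; rewrite E2 /=; have := congr1 size E1.
  by rewrite size_rcons /=; lia.
- move=> L L' /set_mem CL /set_mem CL' fE.
  have [t [vt _ _ E1 E2]] := CH2'_tokens n L CL.
  have [t' [vt' _ _ E1' E2']] := CH2'_tokens n L' CL'.
  have tE : t = t' by rewrite -(push2K t vt) -(push2K t' vt') E2 E2' fE.
  by move: E1; rewrite tE E1' => -[].
- move=> M /MOT3_walk[wM hM szM].
  have [] := push2P M wM; move: (foldl push2 _ _) => t vt t0.
  rewrite hM => l0 E2.
  have [w1 h1] := walk_words1 (Dl 1) t vt.
  (* The preimage of [M] is the first word of [t] with its leading D_1 moved to the end. *)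
  have [L wE] : exists L, unrev_words word1 t = Dl 1 :: L.
    have [||d [_ _]] := decomposition_of_tokens t [::] vt t0; rewrite ?l0 //=.
    rewrite cats0; case: (unrev_words _ _) (size_words t) => [|s L].
      by rewrite E2.
    by move=> _ [-> _]; exists L.
  have CL : CH2' n (rcons L (Dl 1)).
    split; last by exists L.
    apply/CH2_walk; rewrite -cats1 walk_cat foldl_cat size_cat.
    move: w1 h1; rewrite wE l0 => /= wL -> /=; rewrite wL.
    have := size_words t; rewrite wE E2 /= szM; split=> //; lia.
  exists (rcons L (Dl 1)) => //.
  have [t' [vt' _ _ E1' E2']] := CH2'_tokens n _ CL.
  (* [f] is computed from [t']; reading the common word D_1 L with [push1] identifies [t'] with [t],
     so [f] returns [M]. *)
  have tE : t = t'.
    have : (t, @None nat) = (t', None); last by case.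
    rewrite -(push1K t vt) -(push1K t' vt'); congr foldl.
    by move: E1'; rewrite -rcons_cons -wE => /rcons_inj[].
  by move: E2'; rewrite -tE E2 => -[].
Qed.
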